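(* There exists a toric ideal $I_A$ with $\mathrm{codim}(I_A)=3$ which has a Gröbner cone with five facets.
   Context: For an integer matrix $A$ with $n$ columns, the toric ideal is $I_A=\langle x^u-x^v : u,v\in\mathbf{N}^n,\ Au=Av\rangle\subseteq k[x_1,\ldots,x_n]$, i.e. the lattice ideal of $\ker(A)\cap\mathbf{Z}^n$. For a weight vector $\omega$ such that $\mathrm{in}_\omega(I_A)$ (the ideal of $\omega$-initial forms) is a monomial ideal, the Gröbner cone of $\mathrm{in}_\omega(I_A)$ is the closure of the set of weight vectors $\omega'$ with $\mathrm{in}_{\omega'}(I_A)=\mathrm{in}_\omega(I_A)$; it is a polyhedral cone, and its facets are counted. *)

(* Defs.v *)
From HB Require Import structures.
From mathcomp Require Import all_boot all_order all_algebra.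
From mathcomp Require Import boolp classical_sets functions cardinality.
From mathcomp Require Import reals topology.
From mathcomp Require Import mpoly.

Set Implicit Arguments.
Unset Strict Implicit.
Unset Printing Implicit Defensive.

Import Order.TTheory GRing.Theory Num.Theory.
Import numFieldTopology.Exports.

Local Open Scope classical_set_scope.
Local Open Scope ring_scope.

Section Ideals.
Variables (k : fieldType) (n : nat).
Implicit Types I P S : set {mpoly k[n]}.

Definition ideal_generated_by S : set {mpoly k[n]} :=
  [set p | exists s : seq ({mpoly k[n]} * {mpoly k[n]}),
     (forall g, g \in s -> S g.2) /\ p = \sum_(g <- s) g.1 * g.2].

Definition is_monomial_ideal I : Prop :=
  exists M : set 'X_{1..n}, I = ideal_generated_by [set 'X_[k, m] | m in M].

(* [idealr_closed] already requires [1 \notin P]. *)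
Definition is_prime_ideal P : Prop :=
  idealr_closed (mem P) /\ prime_idealr_closed (mem P).

(* Q 0 `<` Q 1 `<` ... `<` Q r, primes of k[x] containing I, that is, a chain
   of length r of primes of k[x]/I; the values Q i with i > r are irrelevant. *)
Definition prime_chain_over I (r : nat) (Q : nat -> set {mpoly k[n]}) : Prop :=
  (forall i, (i <= r)%N -> is_prime_ideal (Q i) /\ I `<=` Q i) /\
  (forall i, (i < r)%N -> Q i `<` Q i.+1).

Definition quotient_krull_dim I (r : nat) : Prop :=
  (exists Q, prime_chain_over I r Q) /\
  (forall s Q, prime_chain_over I s Q -> (s <= r)%N).

(* codim I = n - dim (k[x_1, ..., x_n] / I) *)
Definition has_codim I (c : nat) : Prop :=
  exists2 r, quotient_krull_dim I r & (r + c = n)%N.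

End Ideals.

Definition exponent_col (n : nat) (u : 'X_{1..n}) : 'cV[int]_n :=
  \col_i (u i)%:Z.

Definition toric_ideal (k : fieldType) (d n : nat) (A : 'M[int]_(d, n)) :
    set {mpoly k[n]} :=
  ideal_generated_by
    [set f | exists u v : 'X_{1..n},
       A *m exponent_col u = A *m exponent_col v /\ f = 'X_[u] - 'X_[v]].

Arguments toric_ideal k {d n} A.

Section Initial.
Variables (R : realType) (k : fieldType) (n : nat).
Implicit Types (w : 'rV[R]_n) (I : set {mpoly k[n]}).

Definition weight w (m : 'X_{1..n}) : R := \sum_i w 0 i * (m i)%:R.

(* The terms of maximal w-weight. *)
Definition initial_form w (f : {mpoly k[n]}) : {mpoly k[n]} :=
  \sum_(m <- msupp f | all (fun m' => weight w m' <= weight w m) (msupp f))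
     f@_m *: 'X_[m].

Definition initial_ideal w I : set {mpoly k[n]} :=
  ideal_generated_by [set initial_form w f | f in I].

Definition groebner_cone I w : set 'rV[R]_n :=
  closure [set w' | initial_ideal w' I = initial_ideal w I].

End Initial.

Section Cones.
Variables (R : realType) (n : nat).
Implicit Types C F S : set 'rV[R]_n.

Definition dot (c x : 'rV[R]_n) : R := \sum_i c 0 i * x 0 i.

Definition is_polyhedral_cone C : Prop :=
  exists (m : nat) (B : 'I_m -> 'rV[R]_n), C = [set x | forall i, 0 <= dot (B i) x].

(* The dimension of the linear span of S; for a cone S this is the usual
   dimension, since its affine hull contains 0. *)
Definition has_dim S (r : nat) : Prop :=
  exists U : {vspace 'rV[R]_n},
    [/\ forall x, S x -> x \in U,
        forall V : {vspace 'rV[R]_n}, (forall x, S x -> x \in V) -> (U <= V)%VS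
      & \dim U = r].

Definition is_face C F : Prop :=
  exists2 c : 'rV[R]_n, (forall x, C x -> 0 <= dot c x)
                      & F = C `&` [set x | dot c x = 0].

Definition is_facet C F : Prop :=
  is_face C F /\ exists2 r, has_dim F r & has_dim C r.+1.

Definition is_cone_with_facets C (q : nat) : Prop :=
  is_polyhedral_cone C /\ ([set F | is_facet C F] #= `I_q)%card.

End Cones.

(* Main.v *)
Require Import Defs.
From HB Require Import structures.
From mathcomp Require Import all_boot all_order all_algebra.
From mathcomp Require Import boolp classical_sets functions cardinality.
From mathcomp Require Import reals topology.
From mathcomp Require Import mpoly.
From mathcomp Require Import lra zify.

(* The example is the ideal of the monomial curve (t, t^11, t^25, t^28), with
   w = (4, 11, 15, 18). Twelve binomials x^h - x^t of the ideal satisfy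
   w.h > w.t, and no two monomials of the same degree (for the grading 1, 11,
   25, 28) avoid all heads x^h. Hence, for every w', in_w'(I) is generated by
   the heads if and only if w'.h > w'.t for the twelve binomials: reduction by
   the binomials lowers the w'-weight of each monomial down to that of the only
   head-avoiding monomial of its fiber. The Groebner cone is thus the dual of
   the cone spanned by the twelve vectors h - t, five of which are its extreme
   rays. The codimension is 3 because x_0 has degree 1, so that the coordinate
   ring of the curve is k[t]. *)

Set Implicit Arguments.
Unset Strict Implicit.
Unset Printing Implicit Defensive.

Import Order.TTheory GRing.Theory Num.Theory.
Import numFieldTopology.Exports.

Local Open Scope classical_set_scope.
Local Open Scope ring_scope.

(** * Facets of irredundant polyhedral cones *)

Section Dot.
Variables (R : realType) (n : nat).
Implicit Types c x y : 'rV[R]_n.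

Lemma dotDr c x y : dot c (x + y) = dot c x + dot c y.
Proof. by rewrite -big_split; apply: eq_bigr => i _; rewrite mxE mulrDr. Qed.

Lemma dotZr c a x : dot c (a *: x) = a * dot c x.
Proof. by rewrite mulr_sumr; apply: eq_bigr => i _; rewrite mxE mulrCA. Qed.

Lemma dotNr c x : dot c (- x) = - dot c x.
Proof. by rewrite -scaleN1r dotZr mulN1r. Qed.

Lemma dot0r c : dot c 0 = 0.
Proof. by rewrite -(scale0r 0) dotZr mul0r. Qed.

Lemma dot_sumr c (I : Type) (r : seq I) (P : pred I) (F : I -> 'rV[R]_n) :
  dot c (\sum_(i <- r | P i) F i) = \sum_(i <- r | P i) dot c (F i).
Proof. by apply: big_morph; [exact: dotDr | exact: dot0r]. Qed.

Lemma dot_eq0 c : (forall y, dot c y = 0) -> c = 0.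
Proof.
move=> c0; apply/rowP => i; rewrite mxE -(c0 (delta_mx 0 i)) /dot (bigD1 i) //=.
rewrite big1 ?mxE ?eqxx ?mulr1 ?addr0 // => j /negPf ji.
by rewrite mxE ji andbF mulr0.
Qed.

Fact dot_is_linear c : linear_for ( *%R) (dot c : 'rV[R]_n -> R^o).
Proof. by move=> a x y; rewrite dotDr dotZr. Qed.

HB.instance Definition _ c :=
  GRing.isLinear.Build R 'rV[R]_n R^o ( *%R) (dot c) (dot_is_linear c).

Definition hyperplane c : {vspace 'rV[R]_n} := lker (linfun (dot c : _ -> R^o)).

Lemma mem_hyperplane c x : (x \in hyperplane c) = (dot c x == 0).
Proof. by rewrite memv_ker lfunE. Qed.

(** Rank-nullity: the image of a nonzero form is the whole line. *)
Lemma dim_hyperplane c : c != 0 -> (\dim (hyperplane c)).+1 = n.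
Proof.
move=> c0; have := limg_ker_dim (linfun (dot c : _ -> R^o)) fullv.
rewrite capfv -/(hyperplane c) dimvf /dim /= mul1n; apply: etrans.
rewrite -[LHS]addn1; congr (_ + _)%N; apply/esym/eqP.
rewrite eqn_leq (leq_trans (dimvS (subvf _))) ?dimvf //=.
rewrite lt0n dimv_eq0; apply: contra_neq c0 => f0.
apply: dot_eq0 => y; have : linfun (dot c : _ -> R^o) y \in (0%VS : {vspace R^o}).
  by rewrite -f0 memv_img ?memvf.
by rewrite memv0 lfunE => /eqP.
Qed.

Lemma has_dim_uniq (S : set 'rV[R]_n) r s : has_dim S r -> has_dim S s -> r = s.
Proof.
move=> [U [SU minU <-]] [V [SV minV <-]].
by apply/eqP; rewrite eqn_leq !dimvS ?minU ?minV.
Qed.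

End Dot.

Section Cone.
Variables (R : realType) (n q : nat) (B : 'I_q -> 'rV[R]_n).

Definition open_cone : set 'rV[R]_n := [set x | forall i, 0 < dot (B i) x].
Definition closed_cone : set 'rV[R]_n := [set x | forall i, 0 <= dot (B i) x].

(** Only finitely many strict inequalities are at stake, so the least of their admissible step sizes
    serves for all. The spans of cones and walls are computed by testing each direction [y] in this
    way. *)
Lemma small_perturbation p y :
  exists2 e : R, 0 < e & forall i, 0 < dot (B i) p -> 0 < dot (B i) (p + e *: y).
Proof.
suff [e e0 eP] : exists2 e : R, 0 < e &
    forall i, 0 < dot (B i) p -> e * `|dot (B i) y| < dot (B i) p.
  exists e => // i /eP; rewrite dotDr dotZr.
  have := ler_norm (- (e * dot (B i) y)).
  by rewrite normrN normrM (gtr0_norm e0); lra.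
have [e e0 eP] : exists2 e : R, 0 < e &
    forall i, i \in enum 'I_q -> 0 < dot (B i) p -> e * `|dot (B i) y| < dot (B i) p.
  elim: (enum 'I_q) => [|i s [e e0 eP]]; first by exists 1.
  have [pi|pi] := ltP 0 (dot (B i) p); last first.
    exists e => // j; rewrite inE => /predU1P[-> /(le_lt_trans pi)|/eP//].
    by rewrite ltxx.
  have d0 : 0 < `|dot (B i) y| + 1 by rewrite ltr_pwDr.
  exists (Num.min e (dot (B i) p / (`|dot (B i) y| + 1))).
    by rewrite lt_min e0 divr_gt0.
  move=> j; rewrite inE => /predU1P[-> _|js pj].
    apply: (@le_lt_trans _ _ (dot (B i) p / (`|dot (B i) y| + 1) * `|dot (B i) y|)).
      by rewrite ler_wpM2r ?ge_min ?lexx ?orbT.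
    by rewrite mulrAC -mulrA gtr_pMr// ltr_pdivrMr// mul1r ltrDl.
  by apply: le_lt_trans (eP _ js pj); rewrite ler_wpM2r ?ge_min ?lexx.
by exists e => // i; apply: eP; rewrite mem_enum.
Qed.

(** A form negative at [x] stays negative on a ball around [x]; conversely, a small step from the
    closed cone in the direction [p0] makes every form positive. *)
Lemma closure_open_cone p0 : open_cone p0 -> closure open_cone = closed_cone.
Proof.
move=> p0P; apply/seteqP; split => x.
  move=> xcl i; rewrite leNgt; apply/negP => xi.
  (* [N] exceeds the l1-norm of [B i], so changing each coordinate of [x] by less than
     [- dot (B i) x / N] cannot bring the form up to 0. *)
  pose N := \sum_j `|B i 0 j| + 1.
  have N0 : 0 < N by rewrite ltr_pwDr// sumr_ge0.
  have e0 : 0 < - dot (B i) x / N by rewrite divr_gt0 ?oppr_gt0.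
  have [y [/(_ i) yi xy]] := xcl _ (nbhsx_ballx x _ e0).
  suff : dot (B i) y - dot (B i) x < - dot (B i) x by lra.
  apply: (@le_lt_trans _ _ (\sum_j `|B i 0 j| * (- dot (B i) x / N))).
    have -> : dot (B i) y - dot (B i) x = dot (B i) (y - x) by rewrite dotDr dotNr.
    apply: ler_sum => j _; rewrite !mxE.
    apply: (le_trans (ler_norm _)); rewrite normrM ler_wpM2l// distrC.
    by have [_ /(_ 0 j)/ltW] : @mx_ball 1 n _ R x (- dot (B i) x / N) y := xy.
  rewrite -mulr_suml mulrA ltr_pdivrMr// mulrC ltr_pM2l ?oppr_gt0//.
  by rewrite ltrDl.
move=> xP N /nbhs_ballP[e /= e0 eN].
(* The multiple of [p0] is scaled so that every coordinate moves by less than [e]. *)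
have M0 : 0 < \sum_j `|p0 0 j| + 1 by rewrite ltr_pwDr// sumr_ge0.
have d0 : 0 < e / (\sum_j `|p0 0 j| + 1) by rewrite divr_gt0.
exists (x + e / (\sum_j `|p0 0 j| + 1) *: p0); split.
  by move=> i; rewrite dotDr dotZr ltr_wpDl// mulr_gt0.
apply: eN; split=> // i j; rewrite /ball /= !mxE opprD addNKr.
rewrite normrN normrM gtr0_norm// mulrAC ltr_pdivrMr// ltr_pM2l// ord1.
by rewrite (bigD1 j)//= -addrA ltrDl ltr_wpDl// sumr_ge0.
Qed.

End Cone.

Section Facets.
Variables (R : realType) (n q : nat) (B : 'I_q -> 'rV[R]_n).
Local Notation C := (closed_cone B).

Definition wall i : set 'rV[R]_n := C `&` [set x | dot (B i) x = 0].

Lemma has_dim_closed_cone p0 : open_cone B p0 -> has_dim C n.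
Proof.
move=> p0P; exists fullv; split=> [x _|V CV|]; rewrite ?memvf //; last first.
  by rewrite dimvf /dim /= mul1n.
apply/subvP => y _; have [e e0 ey] := small_perturbation B p0 y.
have : e *: y \in V.
  rewrite -(addKr p0 (e *: y)) addrC rpredB ?CV // => i; last exact: ltW.
  by rewrite ltW ?ey.
by rewrite rpredZeq gt_eqF.
Qed.

(** Since [p] is a relative interior point of the wall, the wall contains [p] plus a small multiple
    of any vector of the hyperplane. *)
Lemma wall_span i p : dot (B i) p = 0 ->
  (forall j, j != i -> 0 < dot (B j) p) ->
  forall V : {vspace 'rV[R]_n},
    (forall x, wall i x -> x \in V) -> (hyperplane (B i) <= V)%VS.
Proof.
move=> pi pP V wV; apply/subvP => y; rewrite mem_hyperplane => /eqP yi.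
have [e e0 ey] := small_perturbation B p y.
have Cj z : dot (B i) z = 0 -> (forall j, j != i -> 0 < dot (B j) z) -> wall i z.
  by move=> zi zj; split=> // j; have [->|/zj/ltW//] := eqVneq j i; rewrite zi.
have : e *: y \in V.
  rewrite -(addKr p (e *: y)) addrC rpredB ?wV //; apply: Cj => // [|j ji].
    by rewrite dotDr dotZr pi yi mulr0 addr0.
  by rewrite ey ?pP.
by rewrite rpredZeq gt_eqF.
Qed.

(* A facet lying on no wall would contain, by summing one point off each wall,
   a point of the open cone, where no nonzero form that is nonnegative on the
   cone can vanish. *)
Lemma facet_is_wall p0 F : open_cone B p0 -> is_facet C F -> exists i, F = wall i.
Proof.
move=> p0P [[c cC FE] [r dF dC]].
have dCn := has_dim_closed_cone p0P.
have rn := has_dim_uniq dC dCn.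
(* The zero form cuts out the whole cone, which is not of codimension one in itself. *)
have [c0|c0] := eqVneq c 0.
  have FC : F = C.
    rewrite FE; apply/seteqP; split=> [x []//|x Cx]; split=> //=.
    by rewrite c0 /dot big1 // => i _; rewrite mxE mul0r.
  by have := has_dim_uniq dF; rewrite FC => /(_ _ dC) /n_Sn.
have [[i Fi]|] := pselect (exists i, forall x, F x -> dot (B i) x = 0).
  exists i.
  have Bi0 : B i != 0.
    apply/eqP => Bi0; have := p0P i; rewrite Bi0 /dot big1 ?ltxx // => j _.
    by rewrite mxE mul0r.
  (* The span of [F] has dimension n - 1 and lies in the hyperplanes of both [B i] and [c], so the
     three coincide. *)
  case: dF => U [FU Umin dU].
  have Uh c' : c' != 0 -> (forall x, F x -> dot c' x = 0) -> U = hyperplane c'.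
    move=> c'0 Fc'; apply/eqP; rewrite eqEdim Umin /=.
      by rewrite -ltnS dim_hyperplane // dU rn.
    by move=> x /Fc'; rewrite mem_hyperplane => ->.
  have UBi := Uh _ Bi0 Fi.
  have Uc : U = hyperplane c by apply: Uh => // x; rewrite FE => -[].
  apply/seteqP; split=> x; first by move=> Fx; split; [move: Fx; rewrite FE => -[]|exact: Fi].
  move=> [Cx /= xi]; rewrite FE; split=> //=.
  by apply/eqP; rewrite -mem_hyperplane -Uc UBi mem_hyperplane xi.
move=> /forallNP noi.
have /choice[p pP] : forall i, exists x, F x /\ 0 < dot (B i) x.
  move=> i; have /existsNP[x /not_implyP[Fx xi]] := noi i.
  exists x; split=> //; rewrite lt_neqAle eq_sym; apply/andP; split; first exact/eqP.
  by move: Fx; rewrite FE => -[/(_ i)].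
have FCc x : F x -> C x /\ dot c x = 0 by rewrite FE.
exfalso; move/eqP: c0; apply; apply: dot_eq0 => y.
pose s := \sum_i p i.
have sP : open_cone B s.
  move=> i; rewrite dot_sumr (bigD1 i) //= ltr_pwDl ?(pP i).2 //.
  by apply: sumr_ge0 => j _; case: (FCc _ (pP j).1).
have sc : dot c s = 0.
  by rewrite dot_sumr big1 // => i _; case: (FCc _ (pP i).1).
have le0 z : 0 <= dot c z.
  have [e e0 ez] := small_perturbation B s z.
  have : C (s + e *: z) by move=> i; rewrite ltW ?ez ?sP.
  by move=> /cC; rewrite dotDr dotZr sc add0r pmulr_rge0.
by apply/eqP; rewrite eq_le le0 andbT -oppr_ge0 -dotNr le0.
Qed.

(** The points [p i] certify irredundancy: each lies on its own wall and strictly inside all other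
    half-spaces. Hence every wall spans its hyperplane, and distinct indices give distinct walls. *)
Lemma irredundant_cone_facets p0 (p : 'I_q -> 'rV[R]_n) :
  open_cone B p0 ->
  (forall i, dot (B i) (p i) = 0) ->
  (forall i j, j != i -> 0 < dot (B j) (p i)) ->
  is_cone_with_facets C q.
Proof.
move=> p0P pi pj; split; first by exists q, B.
have -> : [set F | is_facet C F] =
    (fun k => if insub k is Some i then wall i else set0) @` `I_q.
  apply/seteqP; split=> F /=.
    by move=> /(facet_is_wall p0P)[i ->]; exists (i : nat); rewrite ?ltn_ord ?valK.
  move=> [k kq <-]; rewrite insubT; set i := Sub k kq.
  have Bi0 : B i != 0.
    apply/eqP => Bi0; have := p0P i; rewrite Bi0 /dot big1 ?ltxx // => j _.
    by rewrite mxE mul0r.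
  split; first by exists (B i) => // x /(_ i).
  exists (\dim (hyperplane (B i))).
    exists (hyperplane (B i)); split=> //.
      by move=> x [_ /= xi]; rewrite mem_hyperplane xi.
    exact: wall_span (pi i) (pj i).
  by rewrite dim_hyperplane //; exact: has_dim_closed_cone p0P.
apply: inj_card_eq => k l; rewrite !inE => kq lq; rewrite !insubT => wE.
apply: contrapT => /eqP kl.
have : wall (Sub k kq) (p (Sub k kq)).
  split; last exact: pi.
  by move=> j; have [->|/pj/ltW//] := eqVneq j (Sub k kq); rewrite pi.
rewrite wE => -[_ /= z]; have := pj (Sub k kq) (Sub l lq).
by rewrite z ltxx -val_eqE /= eq_sym => /(_ kl).
Qed.

End Facets.

(** * Initial ideals of monomial curves *)

Section GeneratedIdeal.
Variables (k : fieldType) (n : nat).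
Implicit Types (S T : set {mpoly k[n]}) (p q : {mpoly k[n]}).

Lemma ideal_gen_mem S p : S p -> ideal_generated_by S p.
Proof.
move=> Sp; exists [:: (1, p)]; split; last by rewrite big_seq1 mul1r.
by move=> g; rewrite inE => /eqP->.
Qed.

Lemma ideal_gen0 S : ideal_generated_by S 0.
Proof. by exists [::]; rewrite big_nil. Qed.

Lemma ideal_genD S p q : ideal_generated_by S p -> ideal_generated_by S q ->
  ideal_generated_by S (p + q).
Proof.
move=> [s [sS ->]] [t [tS ->]]; exists (s ++ t); rewrite big_cat; split=> // g.
by rewrite mem_cat => /orP[/sS|/tS].
Qed.

Lemma ideal_genMl S p q : ideal_generated_by S p -> ideal_generated_by S (q * p).
Proof.
move=> [s [sS ->]]; exists [seq (q * g.1, g.2) | g <- s]; split.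
  by move=> _ /mapP[g gs ->]; exact: (sS g gs).
by rewrite big_map mulr_sumr; apply: eq_bigr => g _; rewrite mulrA.
Qed.

Lemma ideal_gen_sum S (I : eqType) (r : seq I) (F : I -> {mpoly k[n]}) :
  (forall i, i \in r -> ideal_generated_by S (F i)) ->
  ideal_generated_by S (\sum_(i <- r) F i).
Proof.
move=> FS; rewrite big_seq; apply: big_rec; first exact: ideal_gen0.
by move=> i p ir; apply: ideal_genD; exact: FS.
Qed.

Lemma ideal_gen_sub S T :
  S `<=` ideal_generated_by T -> ideal_generated_by S `<=` ideal_generated_by T.
Proof.
by move=> ST _ [s [sS ->]]; apply: ideal_gen_sum => g /sS/ST; exact: ideal_genMl.
Qed.

End GeneratedIdeal.

(** * The toric ideal of a one-row matrix and the parametrised curve *)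

Section Grading.
Variables (k : fieldType) (n : nat) (a : 'I_n -> nat).
Implicit Types (u v m : 'X_{1..n}) (f : {mpoly k[n]}).

Definition wdeg m : nat := (\sum_i a i * m i)%N.

Definition grading_mx : 'M[int]_(1, n) := \row_i (a i)%:Z.

Lemma wdegD u v : wdeg (u + v)%MM = (wdeg u + wdeg v)%N.
Proof. by rewrite -big_split; apply: eq_bigr => i _; rewrite mnmDE mulnDr. Qed.

Lemma grading_mxP u v :
  grading_mx *m exponent_col u = grading_mx *m exponent_col v <-> wdeg u = wdeg v.
Proof.
have E m : (grading_mx *m exponent_col m) 0 0 = (wdeg m)%:Z.
  rewrite mxE (big_morph Posz PoszD (erefl _)); apply: eq_bigr => i _.
  by rewrite !mxE PoszM.
split=> [/matrixP/(_ 0 0)|uv]; first by rewrite !E => -[].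
by apply/matrixP => i j; rewrite !ord1 !E uv.
Qed.

Definition curve_map : {mpoly k[n]} -> {poly k} := mmap (@polyC k) (fun i => 'X^(a i)).

HB.instance Definition _ := GRing.RMorphism.on curve_map.

Lemma curve_mapX m : curve_map 'X_[m] = 'X^(wdeg m).
Proof.
rewrite /curve_map mmapX /mmap1 /wdeg -prodrXr.
by apply: eq_bigr => i _; rewrite exprM.
Qed.

Lemma curve_mapZ c f : curve_map (c *: f) = c *: curve_map f.
Proof. by rewrite /curve_map mmapZ mul_polyC. Qed.

(** For [f] in the toric ideal this says that its coefficients sum to zero over each fiber of the
    grading. *)
Lemma coef_curve_map f d :
  (curve_map f)`_d = \sum_(m <- msupp f | wdeg m == d) f@_m.
Proof.
rewrite [in LHS](mpolyE f) raddf_sum coef_sum [RHS]big_mkcond /=; apply: eq_bigr => m _.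
by rewrite curve_mapZ curve_mapX coefZ coefXn eq_sym; case: eqP; rewrite ?mulr1 ?mulr0.
Qed.

Lemma toric_ideal_curve_map f : toric_ideal k grading_mx f -> curve_map f = 0.
Proof.
move=> [s [sS ->]]; rewrite raddf_sum big_seq big1 // => g /sS[u [v [uv ->]]].
by rewrite /= rmorphM rmorphB /= !curve_mapX (grading_mxP u v).1 // subrr mulr0.
Qed.

Lemma toric_ideal_binomial u v :
  wdeg u = wdeg v -> toric_ideal k grading_mx ('X_[u] - 'X_[v]).
Proof. by move=> uv; apply: ideal_gen_mem; exists u, v; rewrite grading_mxP. Qed.

End Grading.

Section InitialForm.
Variables (R : realType) (k : fieldType) (n : nat) (w : 'rV[R]_n).
Implicit Types (f : {mpoly k[n]}).

Lemma weightD u v : weight w (u + v)%MM = weight w u + weight w v.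
Proof.
by rewrite -big_split; apply: eq_bigr => i _; rewrite mnmDE natrD mulrDr.
Qed.

Lemma mcoeff_initial_form f m : (initial_form w f)@_m =
  if all (fun m' => weight w m' <= weight w m) (msupp f) then f@_m else 0.
Proof.
rewrite raddf_sum /=.
have [mf|mf] := boolP (m \in msupp f); last first.
  rewrite big1_seq.
    by rewrite (memN_msupp_eq0 mf) if_same.
  move=> m' /andP[_ m'f]; rewrite mcoeffZ mcoeffX.
  by have [m'm|] := eqVneq m' m; [rewrite -m'm m'f in mf|rewrite mulr0].
rewrite big_mkcond (bigD1_seq m) ?msupp_uniq //= big1 ?addr0.
  by rewrite mcoeffZ mcoeffX eqxx mulr1.
move=> m' /negPf m'm; case: ifP => //= _.
by rewrite mcoeffZ mcoeffX m'm mulr0.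
Qed.

Lemma mcoeff_binomial u v m :
  ('X_[u] - 'X_[v] : {mpoly k[n]})@_m = (u == m)%:R - (v == m)%:R.
Proof. by rewrite mcoeffB !mcoeffX. Qed.

(** Ties are allowed: [v] then survives next to [u]. This is why the cone of a marked basis is cut
    out by strict inequalities. *)
Lemma initial_form_binomial_mcoeff u v : u != v -> weight w u <= weight w v ->
  (initial_form w ('X_[u] - 'X_[v] : {mpoly k[n]}))@_v = -1.
Proof.
move=> uv wuv; rewrite mcoeff_initial_form mcoeff_binomial eqxx (negPf uv) sub0r.
rewrite ifT //; apply/allP => m; rewrite mcoeff_msupp mcoeff_binomial.
have [<- _|um] := eqVneq u m; first exact: wuv.
by have [<-|vm] := eqVneq v m; rewrite // subrr eqxx.
Qed.

Lemma initial_form_binomial u v : weight w v < weight w u ->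
  initial_form w ('X_[u] - 'X_[v] : {mpoly k[n]}) = 'X_[u].
Proof.
move=> wvu; have uv : v != u by apply: contraTneq wvu => ->; rewrite ltxx.
apply/mpolyP => m; rewrite mcoeff_initial_form mcoeffX mcoeff_binomial.
have uf : u \in msupp ('X_[u] - 'X_[v] : {mpoly k[n]}).
  by rewrite mcoeff_msupp mcoeff_binomial eqxx (negPf uv) subr0 oner_eq0.
have [<-|um] := eqVneq u m.
  rewrite (negPf uv) subr0 ifT //; apply/allP => m'.
  rewrite mcoeff_msupp mcoeff_binomial.
  have [<- _|_] := eqVneq u m'; first exact: lexx.
  by have [<- _|_] := eqVneq v m'; rewrite ?(ltW wvu) // subrr eqxx.
have [<-|vm] := eqVneq v m; last by rewrite subrr if_same.
by case: ifP => // /allP/(_ _ uf); rewrite leNgt wvu.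
Qed.

End InitialForm.

(** * Weights selecting a prescribed monomial initial ideal *)

Section MarkedBinomials.
Variables (R : realType) (k : fieldType) (n : nat) (a b : 'I_n -> nat).
Variable G : seq ('X_{1..n} * 'X_{1..n}).

Definition standard (m : 'X_{1..n}) := all (fun g => ~~ (g.1 <= m)%MM) G.

Definition marked_ideal : set {mpoly k[n]} :=
  ideal_generated_by [set 'X_[k, m] | m in [set g.1 | g in [set` G]]].

Definition marked_cone : set 'rV[R]_n :=
  [set w | forall g, g \in G -> weight w g.2 < weight w g.1].

(** A monomial ideal contains a polynomial exactly when it contains each of its monomials, and the
    nonstandard monomials are the multiples of heads. *)
Lemma marked_idealP f :
  marked_ideal f <-> forall m, standard m -> f@_m = 0.
Proof.
split=> [[s [sS ->]] m stm|f0].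
  rewrite raddf_sum big_seq big1 // => g /sS[_ [h hG <-] <-] /=.
  apply: memN_msupp_eq0; rewrite (perm_mem (msuppMX _ _)).
  apply/mapP => -[m' _ mE]; have /negP := allP stm _ hG; apply.
  by rewrite mE lem_addr.
rewrite (mpolyE f); apply: ideal_gen_sum => m; rewrite mcoeff_msupp => fm.
have /allPn[g gG /negPn gm] : ~~ standard m by apply: contraNN fm => /f0/eqP.
rewrite -(submK gm) mpolyXD scalerAl; apply: ideal_genMl.
by apply: ideal_gen_mem; exists g.1 => //; exists g.
Qed.

Hypothesis degG : forall g, g \in G -> wdeg a g.1 = wdeg a g.2.
Hypothesis stdG : forall g, g \in G -> standard g.2.
Hypothesis descG : forall g, g \in G -> (wdeg b g.2 < wdeg b g.1)%N.
Hypothesis std_uniq : forall u v,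
  standard u -> standard v -> wdeg a u = wdeg a v -> u = v.

(* The witness is independent of w in the marked cone; the fixed weight b only
   makes the reduction terminate. *)
Lemma normal_form m : exists s, [/\ standard s, wdeg a s = wdeg a m &
  s = m \/ forall w, marked_cone w -> weight w s < weight w m].
Proof.
have [N] := ubnP (wdeg b m); elim: N m => // N IH m; rewrite ltnS => mN.
have [stm|/allPn[g gG /negPn gm]] := boolP (standard m).
  by exists m; split=> //; left.
(* One reduction step, head replaced by tail: the degree is kept, while the weight [b] and every
   weight of the marked cone drop. *)
pose m' := (m - g.1 + g.2)%MM.
have mE : m = (m - g.1 + g.1)%MM by rewrite submK.
have bm' : (wdeg b m' < wdeg b m)%N.
  by rewrite [in ltnRHS]mE !wdegD ltn_add2l descG.
have [s [sts sm' sw]] := IH m' (leq_trans bm' mN).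
exists s; split=> //; first by rewrite sm' [in RHS]mE !wdegD degG.
right=> w wC; have m'm : weight w m' < weight w m.
  by rewrite [in ltRHS]mE !weightD ltrD2l wC.
by case: sw => [->//|/(_ _ wC)/lt_trans]; apply.
Qed.

(** If [w] does not strictly prefer a head, the initial form of that binomial involves its standard
    tail, which the ideal of heads forbids. Conversely, a standard monomial of an initial form would
    be alone in its fiber, so its coefficient would be the whole, vanishing, fiber sum. *)
Lemma initial_ideal_marked w :
  initial_ideal w (toric_ideal k (grading_mx a)) = marked_ideal <-> marked_cone w.
Proof.
split=> [iI g gG|wC].
  rewrite ltNge; apply/negP => wg.
  have ng : g.1 != g.2.
    by apply: contraTneq (descG gG) => ->; rewrite ltnn.
  have : marked_ideal (initial_form w ('X_[g.1] - 'X_[g.2])).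
    rewrite -iI; apply: ideal_gen_mem; exists ('X_[g.1] - 'X_[g.2]) => //.
    exact/toric_ideal_binomial/degG.
  move=> /marked_idealP/(_ _ (stdG gG))/eqP.
  by rewrite initial_form_binomial_mcoeff // oppr_eq0 oner_eq0.
apply/seteqP; split.
  apply: ideal_gen_sub => _ [f If <-]; apply/marked_idealP => m stm.
  rewrite mcoeff_initial_form; case: ifP => // /allP mtop.
  have := toric_ideal_curve_map If => /(congr1 (fun p : {poly k} => p`_(wdeg a m))).
  rewrite coef_curve_map coef0.
  have [mf|/memN_msupp_eq0//] := boolP (m \in msupp f).
  rewrite big_mkcond (bigD1_seq m) ?msupp_uniq //= eqxx big1_seq ?addr0 //.
  move=> m' /andP[m'm m'f]; case: eqP => // dm'; exfalso.
  (* A second monomial [m'] of the fiber reduces to [m], hence is strictly heavier than [m], against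
     the maximality of [m]. *)
  have [s [sts sm' sw]] := normal_form m'.
  have sE : s = m by apply: std_uniq; rewrite // sm' dm'.
  case: sw => [sm|/(_ _ wC)]; first by rewrite -sm sE eqxx in m'm.
  by rewrite sE ltNge mtop.
apply: ideal_gen_sub => _ [_ [g gG <-] <-]; apply: ideal_gen_mem.
exists ('X_[g.1] - 'X_[g.2]); first exact/toric_ideal_binomial/degG.
by rewrite initial_form_binomial // wC.
Qed.

End MarkedBinomials.

(** * Codimension *)

Section PrimeIdeal.
Variables (k : fieldType) (n : nat).
Implicit Types (P : set {mpoly k[n]}).

Lemma prime_idealP P : is_prime_ideal P <->
  [/\ P 0, ~ P 1, forall f g h, P g -> P h -> P (f * g + h) &
      forall f g, P (f * g) -> P f \/ P g].
Proof.
split=> [[[P0 P1 PD] PM]|[P0 P1 PD PM]].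
  split.
  - by move: P0; rewrite !inE.
  - by move: P1; rewrite notin_setE.
  - by move=> f g h Pg Ph; have := PD f g h; rewrite !inE; apply.
  - move=> f g Pfg; have := PM f g; rewrite !inE => /(_ Pfg)/orP[].
      by rewrite inE; left.
    by rewrite inE; right.
split; first split.
- by rewrite inE.
- by rewrite notin_setE.
- by move=> f g h; rewrite !inE; exact: PD.
- by move=> f g; rewrite inE => /PM[]?; apply/orP; [left|right]; rewrite inE.
Qed.

Lemma kernel_prime (D : idomainType) (phi : {rmorphism {mpoly k[n]} -> D}) :
  is_prime_ideal [set f | phi f = 0].
Proof.
apply/prime_idealP; split=> /=.
- exact: rmorph0.
- by rewrite rmorph1; apply/eqP/oner_neq0.
- by move=> f g h g0 h0; rewrite rmorphD rmorphM g0 h0 mulr0 addr0.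
- by move=> f g; rewrite rmorphM => /eqP; rewrite mulf_eq0 => /orP[]/eqP; [left|right].
Qed.

End PrimeIdeal.

Section CurveCodim.
Variables (k : fieldType) (n : nat) (a : 'I_n.+1 -> nat).
Hypothesis a0 : a ord0 = 1%N.
Implicit Types (f : {mpoly k[n.+1]}) (p q : {poly k}) (P : set {mpoly k[n.+1]}).
Local Notation I := (toric_ideal k (grading_mx a)).

(** A section of [curve_map a], available because x_0 has degree 1. *)
Definition subst_x0 : {poly k} -> {mpoly k[n.+1]} := horner_alg 'X_ord0.

HB.instance Definition _ := GRing.LRMorphism.on subst_x0.

(** Each monomial is congruent modulo the ideal to the power of x_0 of the same degree. *)
Lemma subst_x0_curve_map f : I (f - subst_x0 (curve_map a f)).
Proof.
have -> : f - subst_x0 (curve_map a f) =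
    \sum_(m <- msupp f) (f@_m *: 'X_[m] - subst_x0 (curve_map a (f@_m *: 'X_[m]))).
  by rewrite sumrB -!raddf_sum -mpolyE.
apply: ideal_gen_sum => m _; rewrite curve_mapZ curve_mapX linearZ /= mulr_algl -scalerBr.
rewrite -mul_mpolyC; apply: ideal_genMl.
rewrite rmorphXn /= /subst_x0 horner_algX mpolyXn; apply: toric_ideal_binomial.
set d := wdeg a m; rewrite /wdeg big_ord_recl a0 mul1n mulmnE mnm1E eqxx mul1n big1 ?addn0 //.
by move=> i _; rewrite mulmnE mnm1E mul0n muln0.
Qed.

Lemma toric_idealE : I = [set f | curve_map a f = 0].
Proof.
apply/seteqP; split=> f /=; first exact: toric_ideal_curve_map.
by move=> f0; have := subst_x0_curve_map f; rewrite f0 raddf0 subr0.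
Qed.

Lemma mem_prime_over P f : is_prime_ideal P -> I `<=` P ->
  P f <-> P (subst_x0 (curve_map a f)).
Proof.
move=> /prime_idealP[_ _ PD _] IP; have := IP _ (subst_x0_curve_map f).
set g := subst_x0 _ => Pfg; split=> [Pf|Pg].
  by have := PD (-1) _ _ Pfg Pf; rewrite mulN1r opprB subrK.
by have := PD 1 _ _ Pfg Pg; rewrite mul1r subrK.
Qed.

(* Modulo I everything is a polynomial in x_0; with q of least degree such that
   q(x_0) is in P1 and h(x_0) in P2 but not in P1, gcd(q, h) is constant. *)
Lemma no_chain2 P0 P1 P2 : is_prime_ideal P0 -> is_prime_ideal P1 -> is_prime_ideal P2 ->
  I `<=` P0 -> P0 `<` P1 -> P1 `<` P2 -> False.
Proof.
move=> pP0 pP1 pP2 IP0 [P01 nP10] [P12 nP21].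
have IP1 := subset_trans IP0 P01; have IP2 := subset_trans IP1 P12.
have [P00 _ _ _] := (prime_idealP P0).1 pP0.
have [P10 _ PD1 PM1] := (prime_idealP P1).1 pP1.
have [_ P2n1 PD2 _] := (prime_idealP P2).1 pP2.
have [f P1f nP0f] : exists2 f, P1 f & ~ P0 f.
  by move/existsNP: nP10 => [f /not_implyP[]]; exists f.
have [g P2g nP1g] : exists2 g, P2 g & ~ P1 g.
  by move/existsNP: nP21 => [g /not_implyP[]]; exists g.
pose A N := `[< exists p, [/\ p != 0, P1 (subst_x0 p) & size p = N] >].
have exA : exists N, A N.
  exists (size (curve_map a f)); apply/asboolP; exists (curve_map a f).
  split=> //; last exact/(mem_prime_over f pP1 IP1).
  by apply/eqP => f0; apply/nP0f/(mem_prime_over f pP0 IP0); rewrite f0 raddf0.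
case: (ex_minnP exA) => _ /asboolP[q [q0 P1q <-]] qmin.
have {}qmin p : p != 0 -> P1 (subst_x0 p) -> (size q <= size p)%N.
  by move=> p0 P1p; apply: qmin; apply/asboolP; exists p.
pose h := curve_map a g.
have P2h : P2 (subst_x0 h) by apply/(mem_prime_over g pP2 IP2).
have nP1h : ~ P1 (subst_x0 h) by move/(mem_prime_over g pP1 IP1).
pose d := gcdp q h.
have dq : d %| q := dvdp_gcdl _ _.
have d0 : d != 0 by rewrite gcdp_eq0 negb_and q0.
(* Primality puts one factor of q in P1. If it is d, minimality makes d associate to q, so q divides
   h and h lies in P1; if it is q / d, minimality forces d to be constant. *)
have : P1 (subst_x0 (q %/ d) * subst_x0 d) by rewrite -rmorphM /= divpK.
case/PM1 => [P1qd|P1d]; last first.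
  apply: nP1h; have /dvdpP[c ->] : q %| h.
    suff /eqp_dvdl <- : d %= q by exact: dvdp_gcdr.
    by rewrite -dvdp_size_eqp // eqn_leq dvdp_leq // qmin.
  by rewrite rmorphM /= -[X in P1 X]addr0; apply: PD1.
have qd0 : q %/ d != 0 by rewrite dvdp_div_eq0.
have d1 : size d = 1%N.
  have := qmin _ qd0 P1qd; rewrite size_divp //.
  have : (0 < size q)%N by rewrite size_poly_gt0.
  have : (0 < size d)%N by rewrite size_poly_gt0.
  case: (size d) => [//|e] _; case: (size q) => [//|e'] _ /=; lia.
(* The Bezout combination is a nonzero constant lying in P2, so P2 contains 1. *)
have /Bezout_coprimepP[[u v] /=] : coprimep q h by rewrite /coprimep d1.
set z := (_ + _); rewrite -size_poly_eq1 => /size_poly1P[c c0 zc].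
apply: P2n1; have P2z : P2 (subst_x0 z).
  rewrite rmorphD !rmorphM /=; apply: (PD2) (P12 _ P1q) _.
  by rewrite -[X in P2 X]addr0; apply: PD2 => //; exact: P12.
have := PD2 (subst_x0 c^-1%:P) _ _ P2z (P12 _ P10).
by rewrite addr0 -rmorphM zc -polyCM mulVf // rmorph1.
Qed.

Lemma toric_curve_codim : has_codim I n.
Proof.
exists 1%N => //; split.
  (* The chain goes from the ideal of the curve to that of its point t = 1; x_0 - 1 shows that the
     inclusion is strict. *)
  exists (fun i => if i == 0%N then I else [set f | (horner_eval 1 \o curve_map a) f = 0]).
  split=> [[|i] _|[|//] _] /=.
  - by split=> //; rewrite toric_idealE; exact: (@kernel_prime _ _ {poly k} (curve_map a)).
  - split; first exact: (@kernel_prime _ _ k (horner_eval 1 \o curve_map a)).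
    by rewrite toric_idealE => f /= ->; rewrite /horner_eval horner0.
  rewrite toric_idealE; split=> [f /= ->|]; first by rewrite /horner_eval horner0.
  move=> /(_ ('X_ord0 - 1)) /=; rewrite rmorphB rmorph1 /= curve_mapX.
  have -> : wdeg a U_(ord0) = 1%N.
    rewrite /wdeg big_ord_recl a0 mul1n mnm1E eqxx big1 ?addn0 // => i _.
    by rewrite mnm1E muln0.
  rewrite /horner_eval !hornerE subrr => /(_ erefl)/eqP.
  by rewrite expr1 polyXsubC_eq0.
move=> s Q [Qp Qc]; rewrite leqNgt; apply/negP => s2.
have [pQ0 IQ0] := Qp 0%N isT; have [pQ1 _] := Qp 1%N (ltnW s2); have [pQ2 _] := Qp 2%N s2.
exact: no_chain2 pQ0 pQ1 pQ2 IQ0 (Qc 0%N (ltnW s2)) (Qc 1%N s2).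
Qed.

End CurveCodim.

(** * The curve (t, t^11, t^25, t^28) *)

Section Example.

(** The indices are written with [lift] to match what [big_ord_recl] produces. *)
Definition o0 : 'I_4 := ord0.
Definition o1 : 'I_4 := lift ord0 ord0.
Definition o2 : 'I_4 := lift ord0 (lift ord0 ord0).
Definition o3 : 'I_4 := lift ord0 (lift ord0 (lift ord0 ord0)).

Lemma ord4P (P : 'I_4 -> Prop) : P o0 -> P o1 -> P o2 -> P o3 -> forall i, P i.
Proof.
move=> P0 P1 P2 P3 [[|[|[|[|//]]]] i4].
- by rewrite (_ : Ordinal i4 = o0) //; exact: val_inj.
- by rewrite (_ : Ordinal i4 = o1) //; exact: val_inj.
- by rewrite (_ : Ordinal i4 = o2) //; exact: val_inj.
- by rewrite (_ : Ordinal i4 = o3) //; exact: val_inj.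
Qed.

Definition mon (s : seq nat) : 'X_{1..4} := [multinom nth 0%N s i | i < 4].

Definition degs (i : 'I_4) : nat := nth 0%N [:: 1; 11; 25; 28]%N i.
Definition cost (i : 'I_4) : nat := nth 0%N [:: 4; 11; 15; 18]%N i.

(* Exponents (head, tail) of the reduced Groebner basis for w = (4, 11, 15, 18). *)
Definition basis : seq (seq nat * seq nat) :=
  [:: ([:: 0; 0; 0; 9], [:: 2; 0; 10; 0]);
      ([:: 1; 0; 0; 7], [:: 0; 2; 7; 0]);
      ([:: 0; 1; 0; 5], [:: 1; 0; 6; 0]);
      ([:: 1; 1; 4; 0], [:: 0; 0; 0; 4]);
      ([:: 2; 0; 0; 3], [:: 0; 1; 3; 0]);
      ([:: 0; 3; 1; 0], [:: 2; 0; 0; 2]);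
      ([:: 0; 5; 0; 0], [:: 2; 0; 1; 1]);
      ([:: 0; 2; 0; 1], [:: 0; 0; 2; 0]);
      ([:: 5; 0; 0; 1], [:: 0; 3; 0; 0]);
      ([:: 3; 0; 1; 0], [:: 0; 0; 0; 1]);
      ([:: 3; 2; 0; 0], [:: 0; 0; 1; 0]);
      ([:: 11; 0; 0; 0], [:: 0; 1; 0; 0])]%N.

Definition mon_basis := [seq (mon g.1, mon g.2) | g <- basis].

(** The counterpart of [standard mon_basis] on bare naturals, which [vm_compute] can evaluate. *)
Definition std (x0 x1 x2 x3 : nat) : bool :=
  all (fun g => let h := nth 0%N g.1 in
    ~~ [&& h 0 <= x0, h 1 <= x1, h 2 <= x2 & h 3 <= x3])%N basis.

Lemma std_le x0 x1 x2 x3 y : (y <= x2)%N -> std x0 x1 x2 x3 -> std x0 x1 y x3.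
Proof.
move=> yx; apply: sub_all => g /=; apply: contraNN => /and4P[-> -> gy ->].
by rewrite (leq_trans gy yx).
Qed.

Lemma std_bound x0 x1 x2 x3 :
  std x0 x1 x2 x3 -> [/\ (x0 <= 10)%N, (x1 <= 4)%N & (x3 <= 8)%N].
Proof.
(* Entries 11, 6 and 0 have the pure powers x_0^11, x_1^5 and x_3^9 as heads. *)
move=> /allP st; pose g i := nth ([::], [::]) basis i.
have := st (g 11%N) isT; have := st (g 6%N) isT; have := st (g 0%N) isT.
by rewrite /= !leq0n /= !andbT -!ltnNge; split.
Qed.

(* x_2 <= 11 since a standard monomial without x_2 has degree at most
   10 + 11 * 4 + 28 * 8 < 25 * 12. *)
Definition std_box : seq (nat * nat * nat * nat) :=
  [seq x <- [seq (x01, x23.1, x23.2) |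
               x01 <- [seq (x0, x1) | x0 <- iota 0 11, x1 <- iota 0 5],
               x23 <- [seq (x2, x3) | x2 <- iota 0 12, x3 <- iota 0 9]]
       | let: (x0, x1, x2, x3) := x in std x0 x1 x2 x3].

Definition degq (x : nat * nat * nat * nat) : nat :=
  let: (x0, x1, x2, x3) := x in (x0 + 11 * x1 + 25 * x2 + 28 * x3)%N.

Lemma std_box_uniq :
  all (fun x => (x.1.2 == 0%N) ==> all (fun y => (degq x == degq y) ==> (x == y)) std_box)
    std_box.
Proof. by vm_compute. Qed.

Lemma mem_std_box x0 x1 x2 x3 :
  std x0 x1 x2 x3 -> (x2 <= 11)%N -> (x0, x1, x2, x3) \in std_box.
Proof.
move=> st ?; have [? ? ?] := std_bound st; rewrite mem_filter; apply/andP; split=> //.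
apply/allpairsP; exists ((x0, x1), (x2, x3)); split=> //; apply/allpairsP.
  by exists (x0, x1); rewrite !mem_iota.
by exists (x2, x3); rewrite !mem_iota.
Qed.

(* Dividing both monomials by their common power of x_2, the only variable with
   no power among the heads, leaves finitely many cases. *)
Lemma std_uniq x0 x1 x2 x3 y0 y1 y2 y3 :
  std x0 x1 x2 x3 -> std y0 y1 y2 y3 ->
  degq (x0, x1, x2, x3) = degq (y0, y1, y2, y3) ->
  [/\ x0 = y0, x1 = y1, x2 = y2 & x3 = y3].
Proof.
wlog xy : x0 x1 x2 x3 y0 y1 y2 y3 / (x2 <= y2)%N.
  by move=> W sx sy /[dup] dxy /esym dyx; have [/W|/ltnW/W] := leqP x2 y2;
    [exact|case/(_ _ _ _ _ _ _ sy sx dyx)].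
move=> sx sy; rewrite /degq => dxy.
have sx' : std x0 x1 0 x3 by exact: std_le sx.
have sy' : std y0 y1 (y2 - x2) y3 by apply: std_le sy; exact: leq_subr.
have [? ? ?] := std_bound sx; have [? ? ?] := std_bound sy.
have xB : (x0, x1, 0%N, x3) \in std_box by exact: mem_std_box.
have yB : (y0, y1, (y2 - x2)%N, y3) \in std_box by apply: mem_std_box sy' _; lia.
have /implyP box := allP (implyP (allP std_box_uniq _ xB) isT) _ yB.
have /box/eqP[-> -> yx ->] : degq (x0, x1, 0%N, x3) == degq (y0, y1, (y2 - x2)%N, y3).
  by apply/eqP; rewrite /degq; lia.
by split=> //; lia.
Qed.


Lemma mem_mon_basis (P : 'X_{1..4} * 'X_{1..4} -> Prop) :
  (forall s, s \in basis -> P (mon s.1, mon s.2)) ->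
  forall g, g \in mon_basis -> P g.
Proof. by move=> Ps _ /mapP[s sB ->]; exact: Ps. Qed.

Lemma standard_mon_basis m : standard mon_basis m = std (m o0) (m o1) (m o2) (m o3).
Proof.
rewrite /standard all_map; apply: eq_all => g /=; congr (~~ _).
apply/mnm_lepP/and4P => [le|[? ? ? ?]].
  by move: (le o0) (le o1) (le o2) (le o3); rewrite !mnmE.
by apply: ord4P; rewrite mnmE.
Qed.

Lemma wdeg4 (a : 'I_4 -> nat) m :
  wdeg a m = (a o0 * m o0 + a o1 * m o1 + a o2 * m o2 + a o3 * m o3)%N.
Proof. by rewrite /wdeg !big_ord_recl big_ord0 addn0 !addnA. Qed.

Lemma standard_uniq u v : standard mon_basis u -> standard mon_basis v ->
  wdeg degs u = wdeg degs v -> u = v.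
Proof.
rewrite !standard_mon_basis !wdeg4 /= !mul1n => su sv uv.
by have [? ? ? ?] := std_uniq su sv uv; apply/mnmP; exact: ord4P.
Qed.

Lemma deg_mon_basis g : g \in mon_basis -> wdeg degs g.1 = wdeg degs g.2.
Proof.
move: g; apply: mem_mon_basis => s sB /=; rewrite !wdeg4 !mnmE; apply/eqP.
by move: s sB; apply/allP; vm_compute.
Qed.

Lemma cost_mon_basis g : g \in mon_basis -> (wdeg cost g.2 < wdeg cost g.1)%N.
Proof.
move: g; apply: mem_mon_basis => s sB /=; rewrite !wdeg4 !mnmE.
by move: s sB; apply/allP; vm_compute.
Qed.

Lemma standard_tails g : g \in mon_basis -> standard mon_basis g.2.
Proof.
move: g; apply: mem_mon_basis => s sB; rewrite standard_mon_basis !mnmE.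
by move: s sB; apply/allP; vm_compute.
Qed.

Variable R : realType.

Definition row4 (s : seq R) : 'rV[R]_4 := \row_j nth 0 s j.

Lemma dot4 (c x : 'rV[R]_4) :
  dot c x = c 0 o0 * x 0 o0 + c 0 o1 * x 0 o1 + c 0 o2 * x 0 o2 + c 0 o3 * x 0 o3.
Proof. by rewrite /dot !big_ord_recl big_ord0 addr0 !addrA. Qed.

Lemma weight4 (w : 'rV[R]_4) m : weight w m =
  w 0 o0 * (m o0)%:R + w 0 o1 * (m o1)%:R + w 0 o2 * (m o2)%:R + w 0 o3 * (m o3)%:R.
Proof. by rewrite /weight !big_ord_recl big_ord0 addr0 !addrA. Qed.

(* Head minus tail for the entries 0, 1, 3, 5 and 8 of [basis]. *)
Definition normals (i : 'I_5) : 'rV[R]_4 := row4 (nth [::]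
  [:: [:: -2; 0; -10; 9]; [:: 1; -2; -7; 7]; [:: 1; 1; 4; -4]; [:: -2; 3; 1; -2];
      [:: 5; -3; 0; 1]] i).

(* The i-th point is the sum of the two extreme rays on the i-th facet, modulo
   the lineality space spanned by (1, 11, 25, 28). *)
Definition facet_points (i : 'I_5) : 'rV[R]_4 := row4 (nth [::]
  [:: [:: 2; 4; 5; 6]; [:: 1; -3; -12; -13]; [:: 1; 3; 4; 5]; [:: 1; -4; -12; -13];
      [:: 1; 0; -5; -5]] i).

Definition interior_point : 'rV[R]_4 := row4 [:: 4; 11; 15; 18].

Lemma interior_pointP : open_cone normals interior_point.
Proof.
by case=> [[|[|[|[|[|//]]]]] i5]; rewrite dot4 !mxE /=; lra.
Qed.

Lemma facet_points_eq0 i : dot (normals i) (facet_points i) = 0.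
Proof.
by case: i => [[|[|[|[|[|//]]]]] i5]; rewrite dot4 !mxE /=; lra.
Qed.

Lemma facet_points_gt0 i j : j != i -> 0 < dot (normals j) (facet_points i).
Proof.
case: i => [[|[|[|[|[|//]]]]] i5]; case: j => [[|[|[|[|[|//]]]]] j5] // _;
  by rewrite dot4 !mxE /=; lra.
Qed.

(** Five of the twelve inequalities are the normals themselves; [lra] derives the other seven from
    these five. *)
Lemma marked_coneE : marked_cone mon_basis = open_cone normals.
Proof.
apply/seteqP; split=> w wC.
  have wt s : s \in basis -> weight w (mon s.2) < weight w (mon s.1).
    by move=> sB; apply: (wC (mon s.1, mon s.2)); exact: map_f.
  pose g i := nth ([::], [::]) basis i.
  case=> [[|[|[|[|[|//]]]]] i5]; rewrite dot4 !mxE /=.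
  - by have := wt (g 0%N) isT; rewrite !weight4 !mnmE /=; lra.
  - by have := wt (g 1%N) isT; rewrite !weight4 !mnmE /=; lra.
  - by have := wt (g 3%N) isT; rewrite !weight4 !mnmE /=; lra.
  - by have := wt (g 5%N) isT; rewrite !weight4 !mnmE /=; lra.
  - by have := wt (g 8%N) isT; rewrite !weight4 !mnmE /=; lra.
have [i0 i1 i2 i3 i4] :
    [/\ 0 < 5%N, 1 < 5, 2 < 5, 3 < 5 & 4 < 5]%N by [].
move: (wC (Ordinal i0)) (wC (Ordinal i1)) (wC (Ordinal i2)) (wC (Ordinal i3)) (wC (Ordinal i4)).
rewrite !dot4 !mxE /= => h0 h1 h2 h3 h4.
apply: mem_mon_basis => s sB; rewrite /= !weight4 !mnmE.
move: sB; rewrite !inE.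
by do 11 (case/predU1P => [-> /=|]; first lra); move/eqP => -> /=; lra.
Qed.

End Example.

Theorem theorem3p14 (R : realType) (k : fieldType) :
  exists (d n : nat) (A : 'M[int]_(d, n)) (w : 'rV[R]_n),
    [/\ has_codim (toric_ideal k A) 3,
        is_monomial_ideal (initial_ideal w (toric_ideal k A))
      & is_cone_with_facets (groebner_cone (toric_ideal k A) w) 5].
Proof.
exists 1%N, 4%N, (grading_mx degs), (interior_point R).
(* By [iP], the weights with this initial ideal form exactly the open cone, whose closure is the
   Groebner cone. *)
have iP := initial_ideal_marked k deg_mon_basis standard_tails cost_mon_basis standard_uniq.
have iw : initial_ideal (interior_point R) (toric_ideal k (grading_mx degs)) =
          marked_ideal mon_basis.
  by apply/iP; rewrite marked_coneE; exact: interior_pointP.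
split.
- exact: toric_curve_codim.
- by rewrite iw; eexists.
- have -> : groebner_cone (toric_ideal k (grading_mx degs)) (interior_point R) =
            closed_cone (@normals R).
    rewrite -(closure_open_cone (@interior_pointP R)) -marked_coneE /groebner_cone iw.
    by congr closure; apply/seteqP; split=> w /iP.
  exact: irredundant_cone_facets (@interior_pointP R) (@facet_points_eq0 R)
    (@facet_points_gt0 R).
Qed.
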